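(* Let $\mathbf C=(\mathbf C,\otimes,I)$ be a symmetric (strict) monoidal category with symmetry $\sigma$, closed relative to a full monoidal subcategory $\mathbf P\subset\mathbf C$, and let $\mathbb B=(X,\mu_X,\eta_X,\Delta_X,\varepsilon_X)$ be a bimonoid in $\mathbf C$. Then the category $\mathrm{Rep}_{\mathbf P}(\mathbb B)$ is equipped with a monoidal structure in the following way. The monoidal product of objects $(V,\rho)$ and $(V',\rho')$ is the object $(V\otimes V',\rho'')$, where $\rho''$ is the composition $$X\xrightarrow{\Delta_X}X\otimes X\xrightarrow{\rho\otimes\rho'}\mathbf{end}(V)\otimes\mathbf{end}(V')\xrightarrow{\pi}\mathbf{end}(V\otimes V').$$ The monoidal product of morphisms $f$ and $g$ in $\mathrm{Rep}_{\mathbf P}(\mathbb B)$ coincides with their monoidal product $f\otimes g$ in $\mathbf P$. The unit object of $\mathrm{Rep}_{\mathbf P}(\mathbb B)$ is $(I,\varepsilon_X)$. If $\mathbb B$ is cocommutative (i.e. $\sigma_{X,X}\cdot\Delta_X=\Delta_X$), then the monoidal category $\mathrm{Rep}_{\mathbf P}(\mathbb B)$ is symmetric with $\sigma_{(V,\rho),(V',\rho')}=\sigma_{V,V'}$.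
   Context: Monoidal categories are strict; $f\cdot g$ denotes composition ($g$ first). $\mathbf C$ is closed relative to $\mathbf P$ if there are a bifunctor $\mathbf{hom}\colon\mathbf P^{op}\times\mathbf P\to\mathbf C$ and bijections $\theta_{X,V,W}\colon\mathrm{Hom}(X,\mathbf{hom}(V,W))\to\mathrm{Hom}(X\otimes V,W)$ natural in $X\in\mathbf C$, $V,W\in\mathbf P$. Put $\mathrm{ev}_{V,W}=\theta(\mathrm{id})\colon\mathbf{hom}(V,W)\otimes V\to W$. For $V\in\mathbf P$, $\mathbf{end}(V)=\mathbf{hom}(V,V)$ is a monoid in $\mathbf C$ with multiplication $c_V=\theta^{-1}\big(\mathrm{ev}_{V,V}\cdot(\mathrm{id}\otimes\mathrm{ev}_{V,V})\big)$ and unit $u_V=\theta^{-1}(\mathrm{id}_V)$. The isomorphism $\mathrm{ev}_{I,I}\colon\mathbf{end}(I)=\mathbf{end}(I)\otimes I\to I$ is used to identify the monoid $\mathbf{end}(I)$ with the unit monoid $(I,\mathrm{id}_I,\mathrm{id}_I)$, so that $\varepsilon_X\colon X\to I=\mathbf{end}(I)$. The morphism $\pi\colon\mathbf{hom}(V,W)\otimes\mathbf{hom}(V',W')\to\mathbf{hom}(V\otimes V',W\otimes W')$ is $\pi=\theta^{-1}\big((\mathrm{ev}_{V,W}\otimes\mathrm{ev}_{V',W'})\cdot\sigma^{(23)}\big)$, where $\sigma^{(23)}\colon\mathbf{hom}(V,W)\otimes\mathbf{hom}(V',W')\otimes V\otimes V'\to\mathbf{hom}(V,W)\otimes V\otimes\mathbf{hom}(V',W')\otimes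 V'$ swaps the 2nd and 3rd factors by the symmetry. A bimonoid is an object with monoid and comonoid structures such that $\Delta_X$ and $\varepsilon_X$ are morphisms of monoids. $\mathrm{Rep}_{\mathbf P}(\mathbb B)$ is the category of representations of the underlying monoid $\mathbb M=(X,\mu_X,\eta_X)$: objects are pairs $(V,\rho)$ with $V\in\mathbf P$ and $\rho\colon\mathbb M\to\mathbf{end}(V)$ a morphism of monoids; morphisms $(V,\rho)\to(W,\tau)$ are morphisms $f\colon V\to W$ in $\mathbf P$ with $\mathbf{hom}(\mathrm{id}_V,f)\cdot\rho=\mathbf{hom}(f,\mathrm{id}_W)\cdot\tau$. *)

(* Defs.v *)
From Stdlib Require Import ssreflect ssrfun ProofIrrelevance.

Set Implicit Arguments.
Unset Strict Implicit.
Unset Printing Implicit Defensive.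

Declare Scope cat_scope.
Delimit Scope cat_scope with cat.
Local Open Scope cat_scope.

Reserved Notation "g ∘ f" (at level 40, left associativity).
Reserved Notation "X ⊗ Y" (at level 35, right associativity).

Record category : Type := Category {
  cat_ob :> Type;
  Hom : cat_ob -> cat_ob -> Type;
  idm : forall X, Hom X X;
  comp : forall X Y Z, Hom Y Z -> Hom X Y -> Hom X Z;
  comp1m : forall X Y (f : Hom X Y), comp (idm Y) f = f;
  compm1 : forall X Y (f : Hom X Y), comp f (idm X) = f;
  compA : forall X Y Z T (h : Hom Z T) (g : Hom Y Z) (f : Hom X Y),
    comp h (comp g f) = comp (comp h g) f }.

Arguments Hom {c} X Y : rename.
Arguments idm {c} X : rename.
Arguments comp {c X Y Z} g f : rename.

Notation "g ∘ f" := (comp g f) : cat_scope.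

(* Equalities of objects act as identity morphisms; all the structural
   morphisms of a strict monoidal category are of this form. *)
Definition eqm (C : category) (X Y : C) (e : X = Y) : Hom X Y :=
  match e in _ = Z return Hom X Z with eq_refl => idm X end.

Lemma eqm_irr (C : category) (X Y : C) (e e' : X = Y) : eqm e = eqm e'.
Proof. by rewrite (proof_irrelevance _ e e'). Qed.

Lemma eqmK (C : category) (X Y : C) (e : X = Y) (e' : Y = X) :
  eqm e' ∘ eqm e = idm X.
Proof. by case: _ / e e' => e'; rewrite (proof_irrelevance _ e' erefl) comp1m. Qed.

Lemma eqm_trans (C : category) (X Y Z : C) (e : X = Y) (e' : Y = Z) :
  eqm e' ∘ eqm e = eqm (etrans e e').
Proof. by case: _ / e'; rewrite comp1m. Qed.

Lemma reassoc (C : category) (X Y Y' Z T : C)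
    (g : Hom Y Z) (f : Hom X Y) (g' : Hom Y' Z) (f' : Hom X Y') :
  g ∘ f = g' ∘ f' -> forall k : Hom T X, g ∘ (f ∘ k) = g' ∘ (f' ∘ k).
Proof. by move=> e k; rewrite !compA e. Qed.

Definition op_cat (C : category) : category :=
  @Category C (fun X Y => @Hom C Y X) (fun X => idm X)
    (fun X Y Z g f => f ∘ g)
    (fun X Y f => compm1 f) (fun X Y f => comp1m f)
    (fun X Y Z T h g f => eq_sym (compA f g h)).

Section ProductCategory.
Variables C D : category.
Let ob := (cat_ob C * cat_ob D)%type.
Let hom (X Y : ob) := (Hom X.1 Y.1 * Hom X.2 Y.2)%type.
Let one (X : ob) : hom X X := (idm X.1, idm X.2).
Let cmp (X Y Z : ob) (g : hom Y Z) (f : hom X Y) : hom X Z :=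
  (g.1 ∘ f.1, g.2 ∘ f.2).

Fact prod_comp1m X Y (f : hom X Y) : cmp (one Y) f = f.
Proof. by case: f => f1 f2; rewrite /cmp /= !comp1m. Qed.
Fact prod_compm1 X Y (f : hom X Y) : cmp f (one X) = f.
Proof. by case: f => f1 f2; rewrite /cmp /= !compm1. Qed.
Fact prod_compA X Y Z T (h : hom Z T) (g : hom Y Z) (f : hom X Y) :
  cmp h (cmp g f) = cmp (cmp h g) f.
Proof. by rewrite /cmp /= !compA. Qed.

Definition prod_cat : category := Category prod_comp1m prod_compm1 prod_compA.
End ProductCategory.

Record functor (C D : category) : Type := Functor {
  fob :> C -> D;
  fmor : forall X Y, Hom X Y -> Hom (fob X) (fob Y);
  fmor1 : forall X, fmor (idm X) = idm (fob X);
  fmorM : forall X Y Z (g : Hom Y Z) (f : Hom X Y),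
    fmor (g ∘ f) = fmor g ∘ fmor f }.

Record is_strict_monoidal (C : category) (tob : C -> C -> C)
    (tmor : forall {X X' Y Y' : C},
      Hom X X' -> Hom Y Y' -> Hom (tob X Y) (tob X' Y'))
    (I : C) : Prop := IsStrictMonoidal {
  ism_tmor1 : forall X Y, tmor (idm X) (idm Y) = idm (tob X Y);
  ism_tmorM : forall X X' X'' Y Y' Y''
      (g : Hom X' X'') (f : Hom X X') (g' : Hom Y' Y'') (f' : Hom Y Y'),
    tmor (g ∘ f) (g' ∘ f') = tmor g g' ∘ tmor f f';
  ism_tobA : forall X Y Z, tob (tob X Y) Z = tob X (tob Y Z);
  ism_tob1X : forall X, tob I X = X;
  ism_tobX1 : forall X, tob X I = X;
  ism_tmorA : forall X X' Y Y' Z Z'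
      (f : Hom X X') (g : Hom Y Y') (h : Hom Z Z'),
    eqm (ism_tobA X' Y' Z') ∘ tmor (tmor f g) h =
    tmor f (tmor g h) ∘ eqm (ism_tobA X Y Z);
  ism_tmor1X : forall X X' (f : Hom X X'),
    eqm (ism_tob1X X') ∘ tmor (idm I) f = f ∘ eqm (ism_tob1X X);
  ism_tmorX1 : forall X X' (f : Hom X X'),
    eqm (ism_tobX1 X') ∘ tmor f (idm I) = f ∘ eqm (ism_tobX1 X) }.

Record strict_monoidal (C : category) : Type := StrictMonoidal {
  tob : C -> C -> C;
  tmor : forall X X' Y Y' : C,
    Hom X X' -> Hom Y Y' -> Hom (tob X Y) (tob X' Y');
  unit_ob : C;
  strict_monoidalP : is_strict_monoidal tmor unit_ob }.

Arguments tmor {C} s {X X' Y Y'} f g : rename.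

Section StructuralMorphisms.
Variables (C : category) (M : strict_monoidal C).
Local Notation "X ⊗ Y" := (tob M X Y).
Local Notation I := (unit_ob M).
Let MP := strict_monoidalP M.

Definition assoc_mor X Y Z : Hom ((X ⊗ Y) ⊗ Z) (X ⊗ (Y ⊗ Z)) :=
  eqm (ism_tobA MP X Y Z).
Definition assoc_inv X Y Z : Hom (X ⊗ (Y ⊗ Z)) ((X ⊗ Y) ⊗ Z) :=
  eqm (eq_sym (ism_tobA MP X Y Z)).
Definition lunit_mor X : Hom (I ⊗ X) X := eqm (ism_tob1X MP X).
Definition lunit_inv X : Hom X (I ⊗ X) := eqm (eq_sym (ism_tob1X MP X)).
Definition runit_mor X : Hom (X ⊗ I) X := eqm (ism_tobX1 MP X).
Definition runit_inv X : Hom X (X ⊗ I) := eqm (eq_sym (ism_tobX1 MP X)).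

Record is_symmetry (s : forall X Y, Hom (X ⊗ Y) (Y ⊗ X)) : Prop := IsSymmetry {
  sym_nat : forall X X' Y Y' (f : Hom X X') (g : Hom Y Y'),
    s X' Y' ∘ tmor M f g = tmor M g f ∘ s X Y;
  symK : forall X Y, s Y X ∘ s X Y = idm (X ⊗ Y);
  sym_hexagon : forall X Y Z,
    assoc_mor Y Z X ∘ s X (Y ⊗ Z) ∘ assoc_mor X Y Z =
    tmor M (idm Y) (s X Z) ∘ assoc_mor Y X Z ∘ tmor M (s X Y) (idm Z);
  sym_unit : forall X, lunit_mor X ∘ s X I = runit_mor X }.

End StructuralMorphisms.

Record symmetric_category : Type := SymmetricCategory {
  smc_cat :> category;
  smc_mon : strict_monoidal smc_cat;
  sym : forall X Y, Hom (tob smc_mon X Y) (tob smc_mon Y X);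
  symP : is_symmetry sym }.

Arguments sym {s} X Y : rename.

Notation "X ⊗ Y" := (tob (smc_mon _) X Y) : cat_scope.
Notation "f ⊠ g" := (tmor (smc_mon _) f g)
  (at level 35, right associativity) : cat_scope.
Notation "''I'" := (unit_ob (smc_mon _)) (at level 0) : cat_scope.
Notation asc := (assoc_mor (smc_mon _)).
Notation asc' := (assoc_inv (smc_mon _)).
Notation lun := (lunit_mor (smc_mon _)).
Notation lun' := (lunit_inv (smc_mon _)).
Notation run := (runit_mor (smc_mon _)).
Notation run' := (runit_inv (smc_mon _)).

Section Coherence.
Variable C : symmetric_category.
Let MP := strict_monoidalP (smc_mon C).

Lemma tmor1 (X Y : C) : idm X ⊠ idm Y = idm (X ⊗ Y).
Proof. exact: (ism_tmor1 MP). Qed.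

Lemma tmorM (X X' X'' Y Y' Y'' : C) (g : Hom X' X'') (f : Hom X X')
    (g' : Hom Y' Y'') (f' : Hom Y Y') :
  (g ∘ f) ⊠ (g' ∘ f') = (g ⊠ g') ∘ (f ⊠ f').
Proof. exact: (ism_tmorM MP). Qed.

Lemma tmorl (X X' X'' Y : C) (g : Hom X' X'') (f : Hom X X') :
  (g ∘ f) ⊠ idm Y = (g ⊠ idm Y) ∘ (f ⊠ idm Y).
Proof. by rewrite -tmorM comp1m. Qed.

Lemma tmorr (X Y Y' Y'' : C) (g : Hom Y' Y'') (f : Hom Y Y') :
  idm X ⊠ (g ∘ f) = (idm X ⊠ g) ∘ (idm X ⊠ f).
Proof. by rewrite -tmorM comp1m. Qed.

Lemma tmor_swap (X X' Y Y' : C) (f : Hom X X') (g : Hom Y Y') :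
  (f ⊠ idm Y') ∘ (idm X ⊠ g) = (idm X' ⊠ g) ∘ (f ⊠ idm Y).
Proof. by rewrite -!tmorM !comp1m !compm1. Qed.

Lemma tmor_eqml (X Y Z : C) (e : Y = Z) (e' : Y ⊗ X = Z ⊗ X) :
  eqm e ⊠ idm X = eqm e'.
Proof. by case: _ / e e' => e'; rewrite tmor1 (proof_irrelevance _ e' erefl). Qed.

Lemma tmor_eqmr (X Y Z : C) (e : Y = Z) (e' : X ⊗ Y = X ⊗ Z) :
  idm X ⊠ eqm e = eqm e'.
Proof. by case: _ / e e' => e'; rewrite tmor1 (proof_irrelevance _ e' erefl). Qed.

Lemma asc_nat (X X' Y Y' Z Z' : C) (f : Hom X X') (g : Hom Y Y') (h : Hom Z Z') :
  asc X' Y' Z' ∘ ((f ⊠ g) ⊠ h) = (f ⊠ (g ⊠ h)) ∘ asc X Y Z.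
Proof. exact: (ism_tmorA MP). Qed.

Lemma lun_nat (X X' : C) (f : Hom X X') :
  lun X' ∘ (idm 'I ⊠ f) = f ∘ lun X.
Proof. exact: (ism_tmor1X MP). Qed.

Lemma run_nat (X X' : C) (f : Hom X X') :
  run X' ∘ (f ⊠ idm 'I) = f ∘ run X.
Proof. exact: (ism_tmorX1 MP). Qed.

Lemma runK (X : C) : run' X ∘ run X = idm (X ⊗ 'I).
Proof. exact: eqmK. Qed.

Lemma run'K (X : C) : run X ∘ run' X = idm X.
Proof. exact: eqmK. Qed.

Lemma run'_nat (X X' : C) (f : Hom X X') :
  run' X' ∘ f = (f ⊠ idm 'I) ∘ run' X.
Proof.
rewrite -[LHS]compm1 -(run'K X) !compA -(compA _ f) -run_nat compA runK.
by rewrite comp1m.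
Qed.

Lemma pentagon (X Y Z T : C) :
  asc X Y (Z ⊗ T) ∘ asc (X ⊗ Y) Z T =
  (idm X ⊠ asc Y Z T) ∘ asc X (Y ⊗ Z) T ∘ (asc X Y Z ⊠ idm T).
Proof.
have e1 : X ⊗ ((Y ⊗ Z) ⊗ T) = X ⊗ (Y ⊗ (Z ⊗ T)).
  by rewrite (ism_tobA MP Y Z T).
have e2 : ((X ⊗ Y) ⊗ Z) ⊗ T = (X ⊗ (Y ⊗ Z)) ⊗ T.
  by rewrite (ism_tobA MP X Y Z).
rewrite /assoc_mor (tmor_eqmr _ e1) (tmor_eqml _ e2) !eqm_trans.
exact: eqm_irr.
Qed.

Lemma lun_tens (X Y : C) : lun (X ⊗ Y) ∘ asc 'I X Y = lun X ⊠ idm Y.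
Proof.
have e : ('I ⊗ X) ⊗ Y = X ⊗ Y by rewrite (ism_tob1X MP X).
by rewrite /lunit_mor (tmor_eqml _ e) eqm_trans; exact: eqm_irr.
Qed.

Lemma triangle (X Y : C) : (idm X ⊠ lun Y) ∘ asc X 'I Y = run X ⊠ idm Y.
Proof.
have e : (X ⊗ 'I) ⊗ Y = X ⊗ Y by rewrite (ism_tobX1 MP X).
have e' : X ⊗ ('I ⊗ Y) = X ⊗ Y by rewrite (ism_tob1X MP Y).
rewrite /lunit_mor /runit_mor (tmor_eqml _ e) (tmor_eqmr _ e') eqm_trans.
exact: eqm_irr.
Qed.

End Coherence.

Section Bimonoids.
Variable C : symmetric_category.
Implicit Types X Y Z : C.

(* swaps the second and the third factor *)
Definition sym23 X Y Z T : Hom ((X ⊗ Y) ⊗ (Z ⊗ T)) ((X ⊗ Z) ⊗ (Y ⊗ T)) :=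
  asc' X Z (Y ⊗ T)
  ∘ (idm X ⊠ (asc Z Y T ∘ (sym Y Z ⊠ idm T) ∘ asc' Y Z T))
  ∘ asc X Y (Z ⊗ T).

Record is_monoid X (mu : Hom (X ⊗ X) X) (eta : Hom 'I X) : Prop := IsMonoid {
  monA : mu ∘ (mu ⊠ idm X) = mu ∘ (idm X ⊠ mu) ∘ asc X X X;
  mon1X : mu ∘ (eta ⊠ idm X) = lun X;
  monX1 : mu ∘ (idm X ⊠ eta) = run X }.

Record is_comonoid X (Delta : Hom X (X ⊗ X)) (eps : Hom X 'I) : Prop :=
  IsComonoid {
  comonA : asc X X X ∘ (Delta ⊠ idm X) ∘ Delta = (idm X ⊠ Delta) ∘ Delta;
  comon1X : lun X ∘ (eps ⊠ idm X) ∘ Delta = idm X;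
  comonX1 : run X ∘ (idm X ⊠ eps) ∘ Delta = idm X }.

Definition is_monoid_morphism X (muX : Hom (X ⊗ X) X) (etaX : Hom 'I X)
    Y (muY : Hom (Y ⊗ Y) Y) (etaY : Hom 'I Y) (f : Hom X Y) : Prop :=
  f ∘ muX = muY ∘ (f ⊠ f) /\ f ∘ etaX = etaY.

Definition tens_mul X (mu : Hom (X ⊗ X) X) Y (nu : Hom (Y ⊗ Y) Y) :
    Hom ((X ⊗ Y) ⊗ (X ⊗ Y)) (X ⊗ Y) :=
  (mu ⊠ nu) ∘ sym23 X Y X Y.
Definition tens_one X (eta : Hom 'I X) Y (zeta : Hom 'I Y) : Hom 'I (X ⊗ Y) :=
  (eta ⊠ zeta) ∘ lun' 'I.

Record bimonoid : Type := Bimonoid {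
  bim_ob :> C;
  bim_mul : Hom (bim_ob ⊗ bim_ob) bim_ob;
  bim_one : Hom 'I bim_ob;
  bim_comul : Hom bim_ob (bim_ob ⊗ bim_ob);
  bim_counit : Hom bim_ob 'I;
  bim_monoid : is_monoid bim_mul bim_one;
  bim_comonoid : is_comonoid bim_comul bim_counit;
  bim_comul_morphism :
    is_monoid_morphism bim_mul bim_one
      (tens_mul bim_mul bim_mul) (tens_one bim_one bim_one) bim_comul;
  bim_counit_morphism :
    is_monoid_morphism bim_mul bim_one (lun 'I) (idm 'I) bim_counit }.

Definition cocommutative (B : bimonoid) : Prop :=
  sym B B ∘ bim_comul B = bim_comul B.

End Bimonoids.

Section FullSubcategories.
Variable C : symmetric_category.

Record full_monoidal_subcategory : Type := FullMonoidalSubcategory {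
  in_sub : C -> Prop;
  in_sub_unit : in_sub 'I;
  in_sub_tens : forall V W, in_sub V -> in_sub W -> in_sub (V ⊗ W) }.

Variable P : full_monoidal_subcategory.

Record sub_ob : Type := SubOb { sub_val :> C; sub_valP : in_sub P sub_val }.

Definition sub_cat : category :=
  @Category sub_ob (fun V W => @Hom C V W) (fun V => idm (sub_val V))
    (fun U V W g f => g ∘ f)
    (fun V W f => comp1m f) (fun V W f => compm1 f)
    (fun U V W T h g f => compA h g f).

Definition sub_unit : sub_ob := SubOb (in_sub_unit P).
Definition sub_tens (V W : sub_ob) : sub_ob :=
  SubOb (in_sub_tens (sub_valP V) (sub_valP W)).

Definition hom_bifunctor := functor (prod_cat (op_cat sub_cat) sub_cat) C.

Definition hom_ob (h : hom_bifunctor) (V W : sub_ob) : C := h (V, W).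
Definition hom_mor (h : hom_bifunctor) (V V' W W' : sub_ob)
    (f : @Hom C V' V) (g : @Hom C W W') :
    Hom (hom_ob h V W) (hom_ob h V' W') :=
  @fmor _ _ h (V, W) (V', W') (f, g).

Record relatively_closed : Type := RelativelyClosed {
  ihom :> hom_bifunctor;
  theta : forall (X : C) (V W : sub_ob),
    Hom X (hom_ob ihom V W) -> @Hom C (X ⊗ V) W;
  theta_inv : forall (X : C) (V W : sub_ob),
    @Hom C (X ⊗ V) W -> Hom X (hom_ob ihom V W);
  thetaK : forall X V W, cancel (@theta X V W) (@theta_inv X V W);
  theta_invK : forall X V W, cancel (@theta_inv X V W) (@theta X V W);
  theta_nat : forall (X X' : C) (V V' W W' : sub_ob)
      (a : Hom X (hom_ob ihom V W))
      (k : Hom X' X) (f : @Hom C V' V) (g : @Hom C W W'),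
    theta (hom_mor ihom f g ∘ a ∘ k) = g ∘ theta a ∘ (k ⊠ f) }.

End FullSubcategories.

Arguments theta {C P} r {X V W} a : rename.
Arguments theta_inv {C P} r {X V W} b : rename.

Section InternalEnd.
Variables (C : symmetric_category) (P : full_monoidal_subcategory C).
Variable H : relatively_closed P.
Implicit Types V W : sub_ob P.

Definition ev V W : @Hom C (hom_ob H V W ⊗ V) W := theta H (idm (hom_ob H V W)).

Definition end_ob V : C := hom_ob H V V.

Definition end_mul V : Hom (end_ob V ⊗ end_ob V) (end_ob V) :=
  theta_inv H
    (ev V V ∘ (idm (end_ob V) ⊠ ev V V) ∘ asc (end_ob V) (end_ob V) V).
Definition end_one V : Hom 'I (end_ob V) := theta_inv H (lun (sub_val V)).

Definition hom_tens V W V' W' :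
    Hom (hom_ob H V W ⊗ hom_ob H V' W')
        (hom_ob H (sub_tens V V') (sub_tens W W')) :=
  @theta_inv _ _ H _ (sub_tens V V') (sub_tens W W')
    ((ev V W ⊠ ev V' W') ∘ sym23 (hom_ob H V W) (hom_ob H V' W') V V').

(* The evaluation at the unit object, read as a morphism end(I) -> I. *)
Definition ev_unit : Hom (end_ob (sub_unit P)) 'I :=
  ev (sub_unit P) (sub_unit P) ∘ run' (end_ob (sub_unit P)).

Lemma hom_mor1 V W :
  hom_mor H (idm (sub_val V)) (idm (sub_val W)) = idm (hom_ob H V W).
Proof. exact: (fmor1 (ihom H) (V, W)). Qed.

Lemma hom_morM V V' V'' W W' W'' (f : @Hom C V' V) (f' : @Hom C V'' V')
    (g : @Hom C W W') (g' : @Hom C W' W'') :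
  @hom_mor _ _ H V V'' W W'' (f ∘ f') (g' ∘ g)
  = @hom_mor _ _ H V' V'' W' W'' f' g' ∘ @hom_mor _ _ H V V' W W' f g.
Proof.
exact: (@fmorM _ _ (ihom H) (V, W) (V', W') (V'', W'') (f', g') (f, g)).
Qed.

Lemma theta_comp (X X' : C) V W (a : Hom X (hom_ob H V W)) (k : Hom X' X) :
  theta H (a ∘ k) = theta H a ∘ (k ⊠ idm (sub_val V)).
Proof.
have := theta_nat a k (idm (sub_val V)) (idm (sub_val W)).
by rewrite hom_mor1 !comp1m.
Qed.

Lemma theta_ev (X : C) V W (a : Hom X (hom_ob H V W)) :
  theta H a = ev V W ∘ (a ⊠ idm (sub_val V)).
Proof. by rewrite -theta_comp comp1m. Qed.

Lemma theta_inj (X : C) V W : injective (@theta _ _ H X V W).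
Proof. exact: can_inj (@thetaK _ _ H X V W). Qed.

Lemma ev_end_mul V :
  ev V V ∘ (end_mul V ⊠ idm (sub_val V)) =
  ev V V ∘ (idm (end_ob V) ⊠ ev V V) ∘ asc (end_ob V) (end_ob V) V.
Proof. by rewrite -theta_ev theta_invK. Qed.

Lemma ev_end_one V : ev V V ∘ (end_one V ⊠ idm (sub_val V)) = lun (sub_val V).
Proof. by rewrite -theta_ev theta_invK. Qed.

Lemma theta_end_mul V (X : C) (k : Hom X (end_ob V ⊗ end_ob V)) :
  theta H (end_mul V ∘ k) =
  ev V V ∘ (idm (end_ob V) ⊠ ev V V) ∘ asc (end_ob V) (end_ob V) V
  ∘ (k ⊠ idm (sub_val V)).
Proof. by rewrite theta_comp theta_invK. Qed.

Lemma end_monoid V : is_monoid (end_mul V) (end_one V).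
Proof.
have act := ev_end_mul V; rewrite -compA in act.
split; apply: theta_inj; rewrite -?(compA (end_mul V)) !theta_end_mul -!compA.
- rewrite asc_nat tmor1 (reassoc (esym (tmor_swap _ _))) (reassoc act).
  rewrite tmorl (reassoc (asc_nat _ _ _)) (compA (idm _ ⊠ _) (idm _ ⊠ _)).
  rewrite -tmorr act !tmorr -!compA (compA (idm _ ⊠ asc _ _ _)) -pentagon -(reassoc (asc_nat _ _ _)).
  by rewrite tmor1.
- rewrite asc_nat tmor1 (reassoc (esym (tmor_swap _ _))).
  rewrite (compA (ev V V)) ev_end_one compA lun_nat -compA lun_tens.
  by rewrite -theta_ev.
- rewrite asc_nat (compA (idm _ ⊠ _)) -tmorr ev_end_one triangle.
  by rewrite -theta_ev.
Qed.

(* By the next three lemmas, [ev_unit] is an isomorphism of monoids from end(I)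
   to I with inverse [end_one (sub_unit P)]. *)
Lemma end_unitK : ev_unit ∘ end_one (sub_unit P) = idm 'I.
Proof.
rewrite /ev_unit -compA run'_nat compA.
have -> := ev_end_one (sub_unit P).
exact: eqmK.
Qed.

Lemma ev_unitK : end_one (sub_unit P) ∘ ev_unit = idm (end_ob (sub_unit P)).
Proof.
apply: theta_inj; rewrite theta_comp theta_invK.
have -> : lun (sub_val (sub_unit P)) = run 'I by exact: eqm_irr.
by rewrite run_nat -compA runK compm1.
Qed.

Lemma ev_unit_morphism :
  is_monoid_morphism (end_mul (sub_unit P)) (end_one (sub_unit P))
    (lun 'I) (idm 'I) ev_unit.
Proof.
split; last exact: end_unitK.
set e := end_one (sub_unit P); set mu := end_mul (sub_unit P).
have eM : mu ∘ (e ⊠ e) = e ∘ lun 'I.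
  rewrite -lun_nat -(mon1X (end_monoid (sub_unit P))) -compA -tmorM.
  by rewrite comp1m compm1.
rewrite -[LHS]compm1 -tmor1 -ev_unitK tmorM -compA (reassoc eM) compA.
by rewrite end_unitK comp1m.
Qed.

End InternalEnd.

Section Representations.
Variables (C : symmetric_category) (P : full_monoidal_subcategory C).
Variables (H : relatively_closed P) (B : bimonoid C).

Definition is_rep (V : sub_ob P) (rho : Hom (bim_ob B) (end_ob H V)) : Prop :=
  is_monoid_morphism (bim_mul B) (bim_one B) (end_mul H V) (end_one H V) rho.

Record rep_ob : Type := RepOb {
  rep_space :> sub_ob P;
  rep_map : Hom (bim_ob B) (end_ob H rep_space);
  rep_mapP : is_rep rep_map }.

Implicit Types R S T : rep_ob.

Definition intertwines R S (f : @Hom C R S) : Prop :=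
  hom_mor H (idm (sub_val R)) f ∘ rep_map R =
  hom_mor H f (idm (sub_val S)) ∘ rep_map S.

Record rep_hom R S : Type := RepHom {
  rep_mor :> @Hom C R S;
  rep_morP : intertwines rep_mor }.

Lemma rep_hom_eq R S (f g : rep_hom R S) : rep_mor f = rep_mor g -> f = g.
Proof.
case: f g => [f fP] [g gP] /= e; case: _ / e in gP *.
by rewrite (proof_irrelevance _ fP gP).
Qed.

Lemma intertwines1 R : @intertwines R R (idm (sub_val R)).
Proof. by []. Qed.

Lemma intertwinesM R S T (g : @Hom C S T) (f : @Hom C R S) :
  intertwines g -> intertwines f -> @intertwines R T (g ∘ f).
Proof.
rewrite /intertwines => gP fP.
have hl := hom_morM H (idm (sub_val R)) (idm (sub_val R)) f g.
have hm := hom_morM H f (idm (sub_val R)) (idm (sub_val S)) g.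
have hm' := hom_morM H (idm (sub_val S)) f g (idm (sub_val T)).
have hr := hom_morM H g f (idm (sub_val T)) (idm (sub_val T)).
rewrite !(comp1m, compm1) in hl hm hm' hr.
by rewrite hl -compA fP compA -hm hm' -compA gP compA -hr.
Qed.

Definition rep_id R : rep_hom R R := RepHom (intertwines1 R).
Definition rep_comp R S T (g : rep_hom S T) (f : rep_hom R S) : rep_hom R T :=
  RepHom (intertwinesM (rep_morP g) (rep_morP f)).

Fact rep_comp1m R S (f : rep_hom R S) : rep_comp (rep_id S) f = f.
Proof. by apply: rep_hom_eq; apply: comp1m. Qed.
Fact rep_compm1 R S (f : rep_hom R S) : rep_comp f (rep_id R) = f.
Proof. by apply: rep_hom_eq; apply: compm1. Qed.
Fact rep_compA R S T U (h : rep_hom T U) (g : rep_hom S T) (f : rep_hom R S) :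
  rep_comp h (rep_comp g f) = rep_comp (rep_comp h g) f.
Proof. by apply: rep_hom_eq; apply: compA. Qed.

Definition rep_cat : category := Category rep_comp1m rep_compm1 rep_compA.

Definition rep_tens_map R R' :
    Hom (bim_ob B) (end_ob H (sub_tens R R')) :=
  hom_tens H R R R' R' ∘ (rep_map R ⊠ rep_map R') ∘ bim_comul B.

(* the counit followed by the identification of I with end(I) *)
Definition rep_unit_map : Hom (bim_ob B) (end_ob H (sub_unit P)) :=
  end_one H (sub_unit P) ∘ bim_counit B.

End Representations.

Arguments intertwines {C P H B} R S f.
Arguments RepOb {C P H B} rep_space rep_map rep_mapP.
Arguments RepHom {C P H B} R S rep_mor rep_morP.

(* Main.v *)
From Stdlib Require Import ssreflect ssrfun ProofIrrelevance.
Require Import Defs.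

(** Through the bijections [theta], a representation of the monoid [B] on [V]
    is the same thing as an action [B ⊗ V -> V], and an intertwiner is the same
    thing as an equivariant morphism ([is_repE], [intertwinesE]). Under this
    translation the tensor product of representations becomes the diagonal
    action: duplicate [B] by the comultiplication, move the second copy past the
    first object by the symmetry, and let the two copies act ([tens_action],
    [theta_rep_tens]). The unit becomes the action through the counit.

    Everything then reduces to the axioms of a bimonoid. The diagonal action is
    an action because the comultiplication is a morphism of monoids
    ([tens_actionP]), the trivial one because the counit is
    ([unit_actionP]). Tensor products of equivariant morphisms are equivariant
    by naturality of the symmetry ([tens_action_mor]), and the associativity,
    the unit constraints and the symmetry are equivariant by coassociativity,
    counitality and cocommutativity ([tens_actionA], [tens_action1l],
    [tens_action1r], [tens_action_sym]). The associativity and the unit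
    constraints are identity morphisms of equalities of objects, so their
    equivariance gives equalities between representations ([rep_ob_eq]); all remaining equations hold in the category
    of representations because they hold in [C].

    What these arguments need from the symmetric structure is the behaviour of
    the middle interchange [(X ⊗ Y) ⊗ (Z ⊗ T) -> (X ⊗ Z) ⊗ (Y ⊗ T)]: its
    naturality, its two associativity laws, its unit laws and its compatibility
    with the symmetry ([midN], [mid_asc], [mid_tens_asc], [mid_1l], [mid_lun],
    [mid_run], [mid_sym]). Since the structural morphisms are identities of
    equalities of objects, they are discarded by comparing morphisms with a
    heterogeneous equality [heq]; the laws then reduce to the two hexagons and
    naturality of an elementary exchange [swap]. *)

Set Implicit Arguments.
Unset Strict Implicit.
Unset Printing Implicit Defensive.

Local Open Scope cat_scope.

(** * Heterogeneous equality of morphisms *)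

Section HeterogeneousEquality.
Variable C : category.

(** Equality of two morphisms whose sources and targets are equal, but not
    necessarily convertible, objects: [f] and [g] agree up to the identity
    morphisms [eqm] of the equalities of objects. *)
Definition heq (X Y X' Y' : C) (f : Hom X Y) (g : Hom X' Y') : Prop :=
  exists (e : X = X') (e' : Y = Y'), eqm e' ∘ f = g ∘ eqm e.

Lemma heqW (X Y : C) (f g : Hom X Y) : f = g -> heq f g.
Proof. by move=> ->; exists erefl, erefl; rewrite comp1m compm1. Qed.

(** Between morphisms of the same type this is plain equality, because proofs
    of equality of objects are unique. *)
Lemma heq_eq (X Y : C) (f g : Hom X Y) : heq f g -> f = g.
Proof.
case=> e [e']; rewrite (proof_irrelevance _ e erefl).
by rewrite (proof_irrelevance _ e' erefl) comp1m compm1.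
Qed.

Lemma heq_transport (X Y X' Y' : C) (f : Hom X Y) (g : Hom X' Y')
    (Q : forall X Y, Hom X Y -> Prop) : heq f g -> Q X Y f -> Q X' Y' g.
Proof.
case=> e [e' h]; case: _ / e g h; case: _ / e' => g.
by rewrite /= comp1m compm1 => ->.
Qed.

Lemma heq_sym (X Y X' Y' : C) (f : Hom X Y) (g : Hom X' Y') :
  heq f g -> heq g f.
Proof.
by move=> h; apply: (heq_transport (Q := fun _ _ k => heq k f) h); apply: heqW.
Qed.

Lemma heq_trans (X Y X' Y' X'' Y'' : C)
    (g : Hom X' Y') (f : Hom X Y) (h : Hom X'' Y'') :
  heq f g -> heq g h -> heq f h.
Proof. by move=> fg gh; apply: (heq_transport (Q := fun _ _ k => heq f k) gh). Qed.

Lemma heq_comp (X Y Z X' Y' Z' : C) (g : Hom Y Z) (f : Hom X Y)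
    (g' : Hom Y' Z') (f' : Hom X' Y') :
  heq g g' -> heq f f' -> heq (g ∘ f) (g' ∘ f').
Proof.
case=> e [e' h] [d [d' k]]; case: _ / e' g' h; case: _ / d f' k.
case: _ / e d' => d' f' k g'; rewrite (proof_irrelevance _ d' erefl) in k *.
move: k; rewrite !comp1m !compm1 => -> <-; exact: heqW.
Qed.

Lemma heq_eqml (X Y Z : C) (e : Y = Z) (f : Hom X Y) : heq (eqm e ∘ f) f.
Proof. by case: _ / e; apply: heqW; rewrite comp1m. Qed.

Lemma heq_eqmr (X Y Z : C) (e : X = Y) (f : Hom Y Z) : heq (f ∘ eqm e) f.
Proof. by case: _ / e f => f; apply: heqW; rewrite compm1. Qed.

Lemma heq_eqm (X Y : C) (e : X = Y) : heq (eqm e) (idm X).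
Proof. by case: _ / e; apply: heqW. Qed.

Lemma heq_eqm_cod (X Y : C) (e : X = Y) : heq (eqm e) (idm Y).
Proof. by case: _ / e; apply: heqW. Qed.

Lemma heq_idm (X Y : C) : X = Y -> heq (idm X) (idm Y).
Proof. by move=> ->; apply: heqW. Qed.

(** Inverses of heterogeneously equal isomorphisms: only a left inverse of one
    side and a right inverse of the other are needed. *)
Lemma heq_inv (X Y X' Y' : C) (f : Hom X Y) (f' : Hom Y X)
    (g : Hom X' Y') (g' : Hom Y' X') :
  f' ∘ f = idm X -> g ∘ g' = idm Y' -> heq f g -> heq f' g'.
Proof.
move=> fK gK [e [e' h]]; case: _ / e g g' gK h; case: _ / e' => g g' gK.
rewrite /= comp1m compm1 => h; apply: heqW; rewrite -h in gK.
by rewrite -[f']compm1 -gK compA fK comp1m.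
Qed.

End HeterogeneousEquality.

Notation "f ≃ g" := (heq f g) (at level 70) : cat_scope.

(** * Exchanges of factors in a symmetric strict monoidal category *)

Section Swap.
Variable C : symmetric_category.
Implicit Types X Y Z W : C.
Let MP := strict_monoidalP (smc_mon C).

Lemma heq_tens (X Y X' Y' Z T Z' T' : C) (f : Hom X Y) (f' : Hom X' Y')
    (g : Hom Z T) (g' : Hom Z' T') : f ≃ f' -> g ≃ g' -> f ⊠ g ≃ f' ⊠ g'.
Proof.
move=> hf hg.
apply: (heq_transport (Q := fun _ _ k => f ⊠ g ≃ k ⊠ g') hf).
apply: (heq_transport (Q := fun _ _ k => f ⊠ g ≃ f ⊠ k) hg); exact: heqW.
Qed.

Lemma heq_tensA (X Y X' Y' X'' Y'' : C) (f : Hom X Y) (f' : Hom X' Y')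
    (f'' : Hom X'' Y'') : (f ⊠ f') ⊠ f'' ≃ f ⊠ f' ⊠ f''.
Proof. exists (ism_tobA MP _ _ _), (ism_tobA MP _ _ _); exact: asc_nat. Qed.

Lemma heq_1tens X Y (f : Hom X Y) : idm 'I ⊠ f ≃ f.
Proof. exists (ism_tob1X MP _), (ism_tob1X MP _); exact: lun_nat. Qed.

Lemma heq_tens1 X Y (f : Hom X Y) : f ⊠ idm 'I ≃ f.
Proof. exists (ism_tobX1 MP _), (ism_tobX1 MP _); exact: run_nat. Qed.

Lemma heq_whisker X Y Z T (f : Hom Z T) :
  idm (X ⊗ Y) ⊠ f ≃ idm X ⊠ idm Y ⊠ f.
Proof. rewrite -tmor1; exact: heq_tensA. Qed.

Lemma symN X X' Y Y' (f : Hom X X') (g : Hom Y Y') :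
  sym X' Y' ∘ (f ⊠ g) = (g ⊠ f) ∘ sym X Y.
Proof. exact: (sym_nat (symP C)). Qed.

Lemma heq_sym_1r X : sym X 'I ≃ idm X.
Proof.
apply: (@heq_trans _ _ _ _ _ _ _ (lun X ∘ sym X 'I)).
  by apply: heq_sym; apply: heq_eqml.
rewrite (sym_unit (symP C)); apply: heq_trans (heq_eqm _) _.
by apply: heq_idm; apply: ism_tobX1 MP _.
Qed.

Lemma heq_sym_1l X : sym 'I X ≃ idm X.
Proof.
apply: (heq_inv (f := sym X 'I) (g := idm X)) (heq_sym_1r X).
  exact: symK (symP C) _ _.
exact: comp1m.
Qed.

(** The exchange of the first two of three factors, in right-nested bracketing:
    the elementary move in terms of which the other shuffles are expressed. *)
Definition swap X Y W : Hom (X ⊗ Y ⊗ W) (Y ⊗ X ⊗ W) :=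
  asc Y X W ∘ (sym X Y ⊠ idm W) ∘ asc' X Y W.

Lemma heq_swap X Y W : swap X Y W ≃ sym X Y ⊠ idm W.
Proof. exact: heq_trans (heq_eqmr _ _) (heq_eqml _ _). Qed.

(** The middle interchange. It is [sym23] behind an opaque proof, so that
    rewriting by associativity of composition does not take apart its
    definition as a composite. *)
Fact mid_subproof X Y Z T : {m | m = sym23 X Y Z T}.
Proof. by exists (sym23 X Y Z T). Qed.

Definition mid X Y Z T : Hom ((X ⊗ Y) ⊗ (Z ⊗ T)) ((X ⊗ Z) ⊗ (Y ⊗ T)) :=
  proj1_sig (mid_subproof X Y Z T).

Lemma midE X Y Z T : mid X Y Z T = sym23 X Y Z T.
Proof. exact: proj2_sig (mid_subproof X Y Z T). Qed.

Lemma heq_mid X Y Z T : mid X Y Z T ≃ idm X ⊠ swap Y Z T.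
Proof. rewrite midE; exact: heq_trans (heq_eqmr _ _) (heq_eqml _ _). Qed.

Lemma swapN X X' Y Y' W W' (f : Hom X X') (g : Hom Y Y') (h : Hom W W') :
  swap X' Y' W' ∘ (f ⊠ g ⊠ h) = (g ⊠ f ⊠ h) ∘ swap X Y W.
Proof.
apply: heq_eq.
apply: (@heq_trans _ _ _ _ _ _ _ ((sym X' Y' ⊠ idm W') ∘ ((f ⊠ g) ⊠ h))).
  by apply: heq_comp (heq_swap _ _ _) (heq_sym (heq_tensA _ _ _)).
rewrite -tmorM symN comp1m -[X in _ ⊠ X]compm1 tmorM.
by apply: heq_comp (heq_tensA _ _ _) (heq_sym (heq_swap _ _ _)).
Qed.

Lemma swapK X Y W : swap Y X W ∘ swap X Y W = idm (X ⊗ Y ⊗ W).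
Proof.
apply: heq_eq; apply: heq_trans (heq_comp (heq_swap _ _ _) (heq_swap _ _ _)) _.
rewrite -tmorM (symK (symP C)) comp1m tmor1.
by apply: heq_idm; apply: ism_tobA MP _ _ _.
Qed.

Lemma heq_swap_1r X W : swap X 'I W ≃ idm (X ⊗ W).
Proof.
apply: heq_trans (heq_swap _ _ _) _; rewrite -tmor1.
by apply: heq_tens (heq_sym_1r X) (heqW erefl).
Qed.

Lemma heq_swap_1l X W : swap 'I X W ≃ idm (X ⊗ W).
Proof.
apply: heq_trans (heq_swap _ _ _) _; rewrite -tmor1.
by apply: heq_tens (heq_sym_1l X) (heqW erefl).
Qed.

Lemma heq_swap_tail X Y W W' : swap X Y W ⊠ idm W' ≃ swap X Y (W ⊗ W').
Proof.
apply: heq_trans (heq_tens (heq_swap _ _ _) (heqW erefl)) _.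
apply: heq_trans (heq_tensA _ _ _) _; rewrite tmor1.
exact: heq_sym (heq_swap _ _ _).
Qed.

(** The two hexagons: exchanging past a product is exchanging past each factor
    in turn. *)
Lemma heq_swap_prodr X Y Z W :
  swap X (Y ⊗ Z) W ≃ (idm Y ⊠ swap X Z W) ∘ swap X Y (Z ⊗ W).
Proof.
have hx : sym X (Y ⊗ Z) ≃ (idm Y ⊠ sym X Z) ∘ (asc Y X Z ∘ (sym X Y ⊠ idm Z)).
  rewrite compA -(sym_hexagon (symP C)); apply: heq_sym.
  exact: heq_trans (heq_eqmr _ _) (heq_eqml _ _).
apply: heq_trans (heq_swap _ _ _) _.
apply: heq_trans (heq_tens hx (heqW erefl)) _; rewrite tmorl.
apply: heq_comp.
  apply: heq_trans (heq_tensA _ _ _) _.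
  exact: heq_tens (heqW erefl) (heq_sym (heq_swap _ _ _)).
apply: heq_trans (heq_tens (heq_eqml _ _) (heqW erefl)) _.
apply: heq_trans (heq_tensA _ _ _) _; rewrite tmor1.
exact: heq_sym (heq_swap _ _ _).
Qed.

Lemma heq_swap_prodl X Y Z W :
  swap (X ⊗ Y) Z W ≃ swap X Z (Y ⊗ W) ∘ (idm X ⊠ swap Y Z W).
Proof.
apply: (heq_inv (f := swap Z (X ⊗ Y) W)
  (g := (idm X ⊠ swap Z Y W) ∘ swap Z X (Y ⊗ W))).
- exact: swapK.
- rewrite -compA (compA (swap Z X _)) swapK comp1m -tmorr swapK; exact: tmor1.
- exact: heq_swap_prodr.
Qed.

Lemma midN X X' Y Y' Z Z' T T' (f : Hom X X') (g : Hom Y Y') (h : Hom Z Z')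
    (k : Hom T T') :
  mid X' Y' Z' T' ∘ ((f ⊠ g) ⊠ (h ⊠ k)) =
  ((f ⊠ h) ⊠ (g ⊠ k)) ∘ mid X Y Z T.
Proof.
apply: heq_eq.
apply: heq_trans (heq_comp (heq_mid _ _ _ _) (heq_tensA _ _ _)) _.
rewrite -tmorM swapN comp1m -[X in X ⊠ _]compm1 tmorM.
exact: heq_sym (heq_comp (heq_tensA _ _ _) (heq_mid _ _ _ _)).
Qed.

(** The next two lemmas are the two associativity laws of the interchange:
    [mid_asc] says that it makes the tensor product a monoidal functor,
    [mid_tens_asc] that the associativity of the tensor product is compatible
    with it. In each, both sides consist of three exchanges, two of which are
    brought into the same order by naturality of [swap]. *)
Lemma mid_asc X1 X2 Y1 Y2 Z1 Z2 :
  (asc X1 Y1 Z1 ⊠ asc X2 Y2 Z2) ∘ mid (X1 ⊗ Y1) (X2 ⊗ Y2) Z1 Z2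
    ∘ (mid X1 X2 Y1 Y2 ⊠ idm (Z1 ⊗ Z2)) =
  mid X1 X2 (Y1 ⊗ Z1) (Y2 ⊗ Z2) ∘ (idm (X1 ⊗ X2) ⊠ mid Y1 Y2 Z1 Z2)
    ∘ asc (X1 ⊗ X2) (Y1 ⊗ Y2) (Z1 ⊗ Z2).
Proof.
apply: heq_eq; apply: heq_trans (heq_sym (heq_eqmr _ _)).
apply: (@heq_trans _ _ _ _ _ _ _
  (idm X1 ⊠ ((idm Y1 ⊠ (swap X2 Z1 (Y2 ⊗ Z2) ∘ (idm X2 ⊠ swap Y2 Z1 Z2)))
             ∘ swap X2 Y1 (Y2 ⊗ Z1 ⊗ Z2)))).
  rewrite tmorr; apply: heq_comp.
    apply: heq_trans.
      exact: heq_comp (heq_tens (heq_eqm _) (heq_eqm _)) (heqW erefl).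
    rewrite tmor1 comp1m.
    apply: heq_trans (heq_mid _ _ _ _) _; apply: heq_trans (heq_whisker _ _ _) _.
    do 2 apply: heq_tens (heqW erefl) _; exact: heq_swap_prodl.
  apply: heq_trans (heq_tens (heq_mid _ _ _ _) (heqW erefl)) _.
  apply: heq_trans (heq_tensA _ _ _) _.
  apply: heq_tens (heqW erefl) _; exact: heq_swap_tail.
rewrite (tmorr Y1) -compA -swapN compA tmorr; apply: heq_sym; apply: heq_comp.
  apply: heq_trans (heq_mid _ _ _ _) _.
  apply: heq_tens (heqW erefl) _; exact: heq_swap_prodr.
apply: heq_trans (heq_tens (heqW erefl) (heq_mid _ _ _ _)) _.
exact: heq_whisker.
Qed.

Lemma mid_tens_asc X1 X2 X3 Y1 Y2 Y3 :
  asc (X1 ⊗ Y1) (X2 ⊗ Y2) (X3 ⊗ Y3)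
    ∘ (mid X1 X2 Y1 Y2 ⊠ idm (X3 ⊗ Y3)) ∘ mid (X1 ⊗ X2) X3 (Y1 ⊗ Y2) Y3 =
  (idm (X1 ⊗ Y1) ⊠ mid X2 X3 Y2 Y3) ∘ mid X1 (X2 ⊗ X3) Y1 (Y2 ⊗ Y3)
    ∘ (asc X1 X2 X3 ⊠ asc Y1 Y2 Y3).
Proof.
apply: heq_eq; rewrite -compA; apply: heq_trans (heq_eqml _ _) _.
apply: (@heq_trans _ _ _ _ _ _ _
  (idm X1 ⊠ (swap X2 Y1 (Y2 ⊗ X3 ⊗ Y3)
     ∘ (idm X2 ⊠ ((idm Y1 ⊠ swap X3 Y2 Y3) ∘ swap X3 Y1 (Y2 ⊗ Y3)))))).
  rewrite tmorr; apply: heq_comp.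
    apply: heq_trans (heq_tens (heq_mid _ _ _ _) (heqW erefl)) _.
    apply: heq_trans (heq_tensA _ _ _) _.
    apply: heq_tens (heqW erefl) _; exact: heq_swap_tail.
  apply: heq_trans (heq_mid _ _ _ _) _; apply: heq_trans (heq_whisker _ _ _) _.
  do 2 apply: heq_tens (heqW erefl) _; exact: heq_swap_prodr.
rewrite (tmorr X2) compA swapN -compA tmorr; apply: heq_sym; rewrite -compA.
apply: heq_comp.
  apply: heq_trans (heq_tens (heqW erefl) (heq_mid _ _ _ _)) _.
  exact: heq_whisker.
apply: heq_trans.
  exact: heq_comp (heqW erefl) (heq_tens (heq_eqm_cod _) (heq_eqm_cod _)).
rewrite tmor1 compm1; apply: heq_trans (heq_mid _ _ _ _) _.
apply: heq_tens (heqW erefl) _; exact: heq_swap_prodl.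
Qed.

Lemma mid_1l X Y :
  lun (X ⊗ Y) ∘ (lun 'I ⊠ idm (X ⊗ Y)) = (lun X ⊠ lun Y) ∘ mid 'I 'I X Y.
Proof.
apply: heq_eq; apply: heq_trans (heq_eqml _ _) _.
apply: (@heq_trans _ _ _ _ _ _ _ (idm (X ⊗ Y))).
  apply: heq_trans (heq_tens (heq_eqm_cod _) (heqW erefl)) _.
  exact: heq_1tens.
apply: heq_sym; apply: heq_trans.
  exact: heq_comp (heq_tens (heq_eqm _) (heq_eqm _)) (heqW erefl).
rewrite tmor1 comp1m; apply: heq_trans (heq_mid _ _ _ _) _.
apply: heq_trans (heq_1tens _) _; exact: heq_swap_1l.
Qed.

Lemma mid_run X Y :
  run (X ⊗ Y) ∘ (idm (X ⊗ Y) ⊠ lun 'I) ∘ mid X 'I Y 'I = run X ⊠ run Y.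
Proof.
apply: heq_eq; rewrite -compA; apply: heq_trans (heq_eqml _ _) _.
apply: (@heq_trans _ _ _ _ _ _ _ (idm (X ⊗ Y))).
  apply: heq_trans.
    exact: heq_comp (heq_tens (heqW erefl) (heq_eqm _)) (heqW erefl).
  rewrite tmor1 comp1m; apply: heq_trans (heq_mid _ _ _ _) _.
  apply: heq_trans (heq_tens (heqW erefl) (heq_swap_1l _ _)) _; rewrite tmor1.
  by apply: heq_idm; rewrite (ism_tobX1 MP).
by rewrite -tmor1; apply: heq_tens; apply: heq_sym; apply: heq_eqm_cod.
Qed.

Lemma mid_lun X Y :
  lun (X ⊗ Y) ∘ (lun 'I ⊠ idm (X ⊗ Y)) ∘ mid 'I X 'I Y = lun X ⊠ lun Y.
Proof.
apply: heq_eq; rewrite -compA; apply: heq_trans (heq_eqml _ _) _.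
apply: (@heq_trans _ _ _ _ _ _ _ (idm (X ⊗ Y))).
  apply: heq_trans.
    exact: heq_comp (heq_tens (heq_eqm _) (heqW erefl)) (heqW erefl).
  rewrite tmor1 comp1m; apply: heq_trans (heq_mid _ _ _ _) _.
  apply: heq_trans (heq_1tens _) _; exact: heq_swap_1r.
by rewrite -tmor1; apply: heq_tens; apply: heq_sym; apply: heq_eqm_cod.
Qed.

(** The symmetry is compatible with the interchange. Of the four exchanges that
    make up the symmetry on the left, one cancels against the interchange. *)
Lemma mid_sym X1 X2 Y1 Y2 :
  sym (X1 ⊗ Y1) (X2 ⊗ Y2) ∘ mid X1 X2 Y1 Y2 =
  mid X2 X1 Y2 Y1 ∘ (sym X1 X2 ⊠ sym Y1 Y2).
Proof.
apply: heq_eq.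
(* A trailing unit factor lets the symmetry itself be read as an exchange. *)
have symE Z T : sym Z T ≃ swap Z T 'I.
  exact: heq_sym (heq_trans (heq_swap _ _ _) (heq_tens1 _)).
apply: (@heq_trans _ _ _ _ _ _ _
  ((idm X2 ⊠ swap X1 Y2 (Y1 ⊗ 'I)) ∘ swap X1 X2 (Y2 ⊗ Y1 ⊗ 'I)
   ∘ (idm X1 ⊠ idm X2 ⊠ swap Y1 Y2 'I))).
  apply: (@heq_trans _ _ _ _ _ _ _
    ((idm X2 ⊠ swap X1 Y2 (Y1 ⊗ 'I)) ∘ swap X1 X2 (Y2 ⊗ Y1 ⊗ 'I)
     ∘ (idm X1 ⊠ ((idm X2 ⊠ swap Y1 Y2 'I) ∘ swap Y1 X2 (Y2 ⊗ 'I)))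
     ∘ (idm X1 ⊠ swap X2 Y1 (Y2 ⊗ 'I)))).
    apply: heq_comp.
      apply: heq_trans (symE _ _) _; apply: heq_trans (heq_swap_prodl _ _ _ _) _.
      apply: heq_comp (heq_swap_prodr _ _ _ _) _.
      apply: heq_tens (heqW erefl) _; exact: heq_swap_prodr.
    apply: heq_trans (heq_mid _ _ _ _) _; apply: heq_tens (heqW erefl) _.
    exact: heq_trans (heq_sym (heq_tens1 _)) (heq_swap_tail _ _ _ _).
  by rewrite -compA -tmorr -(compA (idm X2 ⊠ swap Y1 _ _)) swapK compm1; apply: heqW.
rewrite -(compA (idm X2 ⊠ _)); apply: heq_comp.
  apply: heq_trans (heq_sym (heq_mid _ _ _ _)).
  apply: heq_tens (heqW erefl) _.
  apply: heq_trans (heq_sym (heq_swap_tail _ _ _ _)) (heq_tens1 _).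
apply: (@heq_trans _ _ _ _ _ _ _
  ((sym X1 X2 ⊠ idm (Y2 ⊗ Y1)) ∘ (idm (X1 ⊗ X2) ⊠ sym Y1 Y2))).
  apply: heq_comp.
    apply: heq_trans (heq_swap _ _ _) _; apply: heq_tens (heqW erefl) _.
    by apply: heq_idm; rewrite (ism_tobX1 MP).
  apply: heq_sym; apply: heq_trans (heq_whisker _ _ _) _.
  do 2 apply: heq_tens (heqW erefl) _; exact: symE.
by apply: heqW; rewrite -tmorM comp1m compm1.
Qed.

End Swap.

(** * Actions of a bimonoid *)

Section Actions.
Variables (C : symmetric_category) (B : bimonoid C).
Implicit Types V W : C.

Local Notation mu := (bim_mul B).
Local Notation eta := (bim_one B).
Local Notation Delta := (bim_comul B).
Local Notation eps := (bim_counit B).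

(** Actions of the underlying monoid of the bimonoid on an object, by a morphism
    [a] from the tensor product. *)
Definition is_action V (a : Hom (B ⊗ V) V) : Prop :=
  a ∘ (mu ⊠ idm V) = a ∘ (idm B ⊠ a) ∘ asc B B V /\ a ∘ (eta ⊠ idm V) = lun V.

(** The diagonal action on a tensor product: the bimonoid is duplicated by the
    comultiplication and each copy acts on its own factor. *)
Definition tens_action V (a : Hom (B ⊗ V) V) V' (a' : Hom (B ⊗ V') V') :
    Hom (B ⊗ V ⊗ V') (V ⊗ V') :=
  (a ⊠ a') ∘ mid B B V V' ∘ (Delta ⊠ idm (V ⊗ V')).

(** The trivial action on the unit object, through the counit. *)
Definition unit_action : Hom (B ⊗ 'I) 'I := lun 'I ∘ (eps ⊠ idm 'I).

Lemma midNl X X' Y Y' V V' (f : @Hom C X X') (g : Hom Y Y') :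
  mid X' Y' V V' ∘ ((f ⊠ g) ⊠ idm (V ⊗ V')) =
  ((f ⊠ idm V) ⊠ (g ⊠ idm V')) ∘ mid X Y V V'.
Proof. by rewrite -tmor1 midN. Qed.

Lemma midNr X Y V V' W W' (f : @Hom C V W) (g : Hom V' W') :
  mid X Y W W' ∘ (idm (X ⊗ Y) ⊠ (f ⊠ g)) =
  ((idm X ⊠ f) ⊠ (idm Y ⊠ g)) ∘ mid X Y V V'.
Proof. by rewrite -tmor1 midN. Qed.

(** This is where the comultiplication being a morphism of monoids is used. *)
Lemma tens_actionP V (a : Hom (B ⊗ V) V) V' (a' : Hom (B ⊗ V') V') :
  is_action a -> is_action a' -> is_action (tens_action a a').
Proof.
case=> [aM a1] [a'M a'1]; have [DM D1] := bim_comul_morphism B.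
split; rewrite /tens_action -!(compA _ _ (_ ⊠ idm (V ⊗ V'))) -tmorl.
  rewrite DM /tens_mul -midE !tmorl -!compA (reassoc (midNl _ _ _ _)).
  rewrite (compA (a ⊠ a')) -tmorM aM a'M !tmorM.
  have assoc := mid_asc B B B B V V'; rewrite -!compA in assoc.
  rewrite -!compA (compA (mid (B ⊗ B) _ _ _)) (compA (asc _ _ _ ⊠ _)) assoc.
  rewrite -!compA asc_nat; congr (_ ∘ _).
  rewrite -(reassoc (midNr _ _ _ _)); congr (_ ∘ _).
  rewrite !compA -!tmorr; congr (_ ∘ _).
  by rewrite -!tmorM !comp1m compm1.
rewrite D1 /tens_one tmorl -!compA (reassoc (midNl _ _ _ _)) compA -tmorM a1 a'1.
rewrite compA -mid_1l -compA -tmorl eqmK tmor1; exact: compm1.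
Qed.

Lemma unit_actionP : is_action unit_action.
Proof.
have [eM e1] := bim_counit_morphism B; rewrite /unit_action.
split; rewrite -compA -tmorl; last by rewrite e1 tmor1 compm1.
(* The two unit constraints at the unit object are identities of the same
   equality of objects. *)
have lrun : lun 'I = run 'I :> @Hom C _ _ by exact: eqm_irr.
rewrite eM {2}lrun tmorl -triangle -!compA; congr (_ ∘ _).
rewrite asc_nat !compA; congr (_ ∘ _).
by rewrite -!tmorM !comp1m compm1.
Qed.


Lemma tens_action_mor V W (a : Hom (B ⊗ V) V) (b : Hom (B ⊗ W) W)
    V' W' (a' : Hom (B ⊗ V') V') (b' : Hom (B ⊗ W') W')
    (f : Hom V W) (f' : Hom V' W') :
  f ∘ a = b ∘ (idm B ⊠ f) -> f' ∘ a' = b' ∘ (idm B ⊠ f') ->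
  (f ⊠ f') ∘ tens_action a a' = tens_action b b' ∘ (idm B ⊠ (f ⊠ f')).
Proof.
move=> fE f'E; rewrite /tens_action -!compA tmor_swap.
rewrite (reassoc (midNr _ _ _ _)) !(compA _ (_ ⊠ _) (_ ∘ _)) -!tmorM.
by rewrite fE f'E.
Qed.

(** The four lemmas below say that the structural morphisms are equivariant:
    the associativity by coassociativity, the unit constraints by counitality,
    the symmetry by cocommutativity. *)
Lemma tens_actionA V (a : Hom (B ⊗ V) V) V' (a' : Hom (B ⊗ V') V')
    V'' (a'' : Hom (B ⊗ V'') V'') :
  asc V V' V'' ∘ tens_action (tens_action a a') a'' =
  tens_action a (tens_action a' a'') ∘ (idm B ⊠ asc V V' V'').
Proof.
have coA := comonA (bim_comonoid B).
rewrite -compA in coA; rewrite /tens_action.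
have -> : ((a ⊠ a') ∘ mid B B V V' ∘ (Delta ⊠ idm (V ⊗ V'))) ⊠ a'' =
    ((a ⊠ a') ⊠ a'') ∘ (mid B B V V' ⊠ idm (B ⊗ V''))
    ∘ ((Delta ⊠ idm (V ⊗ V')) ⊠ (idm B ⊠ idm V'')).
  by rewrite tmor1 -!tmorM !compm1.
have -> : a ⊠ ((a' ⊠ a'') ∘ mid B B V' V'' ∘ (Delta ⊠ idm (V' ⊗ V''))) =
    (a ⊠ a' ⊠ a'') ∘ (idm (B ⊗ V) ⊠ mid B B V' V'')
    ∘ ((idm B ⊠ idm V) ⊠ (Delta ⊠ idm (V' ⊗ V''))).
  by rewrite tmor1 -!tmorM !compm1.
rewrite -!compA -!(reassoc (midN _ _ _ _)) tmor1 (reassoc (asc_nat _ _ _)).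
have coh := mid_tens_asc B B B V V' V''; rewrite -!compA in coh.
rewrite (compA (mid _ _ _ _ ⊠ _)) (reassoc coh) tmor1 -!compA -!tmorM coA.
by rewrite !comp1m !compm1.
Qed.

Lemma tens_action1l V (a : Hom (B ⊗ V) V) :
  lun V ∘ tens_action unit_action a = a ∘ (idm B ⊠ lun V).
Proof.
have co1 := comon1X (bim_comonoid B).
have -> : tens_action unit_action a =
    (idm 'I ⊠ a) ∘ (lun 'I ⊠ idm (B ⊗ V)) ∘ mid 'I B 'I V
    ∘ (((eps ⊠ idm B) ∘ Delta) ⊠ idm ('I ⊗ V)).
  rewrite tmorl compA -(compA _ (mid _ _ _ _)) midNl tmor1 compA.
  by rewrite -!tmorM !comp1m !compm1.
rewrite !compA lun_nat -!compA (compA (_ ⊠ _)) !(compA (lun (B ⊗ V))) mid_lun.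
by rewrite -tmorM compm1 compA co1.
Qed.

Lemma tens_action1r V (a : Hom (B ⊗ V) V) :
  run V ∘ tens_action a unit_action = a ∘ (idm B ⊠ run V).
Proof.
have co1 := comonX1 (bim_comonoid B).
have -> : tens_action a unit_action =
    (a ⊠ idm 'I) ∘ (idm (B ⊗ V) ⊠ lun 'I) ∘ mid B 'I V 'I
    ∘ (((idm B ⊠ eps) ∘ Delta) ⊠ idm (V ⊗ 'I)).
  rewrite tmorl compA -(compA _ (mid _ _ _ _)) midNl tmor1 compA.
  by rewrite -!tmorM !comp1m !compm1.
rewrite !compA run_nat -!compA (compA (_ ⊠ _)) !(compA (run (B ⊗ V))) mid_run.
by rewrite -tmorM compm1 compA co1.
Qed.

Lemma tens_action_sym V (a : Hom (B ⊗ V) V) V' (a' : Hom (B ⊗ V') V') :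
  cocommutative B ->
  sym V V' ∘ tens_action a a' = tens_action a' a ∘ (idm B ⊠ sym V V').
Proof.
move=> cc; rewrite /tens_action !compA symN -(compA _ (sym _ _)) mid_sym.
by rewrite -!compA -!tmorM cc comp1m !compm1.
Qed.
End Actions.

(** * Representations *)

Section RepresentationsAsActions.
Variables (C : symmetric_category) (P : full_monoidal_subcategory C).
Variables (H : relatively_closed P) (B : bimonoid C).
Implicit Types V W : sub_ob P.
Implicit Types R S T : rep_ob H B.
Let MP := strict_monoidalP (smc_mon C).

Lemma theta_end_mul_tens V X (rho : @Hom C X (end_ob H V)) :
  theta H (end_mul H V ∘ (rho ⊠ rho)) =
  theta H rho ∘ (idm X ⊠ theta H rho) ∘ asc X X V.
Proof.
rewrite theta_end_mul -compA asc_nat (theta_ev rho) tmorr -!compA.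
congr (_ ∘ _); rewrite !compA; congr (_ ∘ _).
by rewrite -!tmorM !comp1m !compm1.
Qed.

(** Transposition along [theta] turns representations into actions. *)
Lemma is_repE V (rho : Hom (bim_ob B) (end_ob H V)) :
  is_rep rho <-> is_action (theta H rho).
Proof.
rewrite /is_rep /is_monoid_morphism /is_action -!theta_comp -theta_end_mul_tens.
have one : theta H (end_one H V) = lun (sub_val V) := theta_invK _ _.
rewrite -one; split=> -[hM h1]; first by rewrite hM h1.
by split; apply: theta_inj.
Qed.

(** Transposition along [theta] turns intertwiners into equivariant
    morphisms. *)
Lemma intertwinesE R S (f : @Hom C R S) :
  intertwines R S f <->
  f ∘ theta H (rep_map R) = theta H (rep_map S) ∘ (idm (bim_ob B) ⊠ f).
Proof.
have hl := theta_nat (rep_map R) (idm (bim_ob B)) (idm (sub_val R)) f.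
have hr := theta_nat (rep_map S) (idm (bim_ob B)) f (idm (sub_val S)).
rewrite tmor1 !compm1 in hl; rewrite compm1 comp1m in hr.
rewrite /intertwines -hl -hr; split=> [-> // | h]; exact: theta_inj h.
Qed.

Lemma theta_rep_tens R S :
  theta H (rep_tens_map R S) =
  tens_action (theta H (rep_map R)) (theta H (rep_map S)).
Proof.
rewrite /rep_tens_map -compA /hom_tens theta_comp theta_invK -midE.
rewrite tmorl /tens_action -!compA (reassoc (midNl _ _ _ _)) compA -tmorM.
by rewrite -!theta_ev !compA.
Qed.

Lemma theta_rep_unit : theta H (rep_unit_map H B) = unit_action B.
Proof. by rewrite /rep_unit_map theta_comp theta_invK. Qed.

Lemma rep_tensP R S : is_rep (rep_tens_map R S).
Proof.
apply/is_repE; rewrite theta_rep_tens.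
by apply: tens_actionP; apply/is_repE; apply: rep_mapP.
Qed.

Lemma rep_unitP : is_rep (rep_unit_map H B).
Proof. apply/is_repE; rewrite theta_rep_unit; exact: unit_actionP. Qed.

(** The tensor product of two representations. *)
Definition rep_tens R S : rep_ob H B :=
  RepOb (sub_tens R S) (rep_tens_map R S) (rep_tensP R S).

(** The trivial representation. *)
Definition rep_unit : rep_ob H B :=
  RepOb (sub_unit P) (rep_unit_map H B) rep_unitP.

Lemma rep_tens_morP R S R' S' (f : rep_hom R S) (f' : rep_hom R' S') :
  intertwines (rep_tens R R') (rep_tens S S') (f ⊠ f').
Proof.
apply/intertwinesE; rewrite !theta_rep_tens.
by apply: tens_action_mor; apply/intertwinesE; apply: rep_morP.
Qed.

(** The tensor product of two intertwiners. *)
Definition rep_tens_mor R S R' S' (f : rep_hom R S) (f' : rep_hom R' S') :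
    rep_hom (rep_tens R R') (rep_tens S S') :=
  RepHom (rep_tens R R') (rep_tens S S') (f ⊠ f') (rep_tens_morP f f').

(** Representations on equal objects are equal as soon as the identity morphism
    of that equality intertwines them. This is how the strict associativity and
    unit laws on objects follow from equivariance of [asc], [lun] and [run]. *)
Lemma rep_ob_eq R S (e : sub_val R = sub_val S) :
  intertwines R S (eqm e) -> R = S.
Proof.
case: R S e => [[V VP] rho rhoP] [[W WP] tau tauP] /= e.
case: _ / e in WP tau tauP *; rewrite (proof_irrelevance _ WP VP) in tau tauP *.
rewrite /intertwines /= hom_mor1 !comp1m => e; case: _ / e in tauP *.
by rewrite (proof_irrelevance _ tauP rhoP).
Qed.

(** The identity morphism of an equality of representations is, on underlying
    objects, the identity morphism of any equality between them. *)
Lemma rep_mor_eqm R S (e : R = S :> rep_cat H B) (e' : sub_val R = sub_val S) :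
  rep_mor (eqm e) = eqm e'.
Proof. by case: _ / e e' => e'; rewrite (proof_irrelevance _ e' erefl). Qed.

Lemma rep_tensA R S T :
  rep_tens (rep_tens R S) T = rep_tens R (rep_tens S T).
Proof.
apply: (@rep_ob_eq (rep_tens (rep_tens R S) T) (rep_tens R (rep_tens S T))
  (ism_tobA MP R S T)).
by apply/intertwinesE; rewrite !theta_rep_tens; apply: tens_actionA.
Qed.

Lemma rep_tens1l R : rep_tens rep_unit R = R.
Proof.
apply: (@rep_ob_eq (rep_tens rep_unit R) R
  (ism_tob1X MP R)).
apply/intertwinesE; rewrite theta_rep_tens theta_rep_unit; exact: tens_action1l.
Qed.

Lemma rep_tens1r R : rep_tens R rep_unit = R.
Proof.
apply: (@rep_ob_eq (rep_tens R rep_unit) R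
  (ism_tobX1 MP R)).
apply/intertwinesE; rewrite theta_rep_tens theta_rep_unit; exact: tens_action1r.
Qed.

Lemma rep_mor_tensA R S T
    (e : rep_tens (rep_tens R S) T = rep_tens R (rep_tens S T) :> rep_cat H B) :
  rep_mor (eqm e) = asc (sub_val R) S T.
Proof. exact: rep_mor_eqm. Qed.

Lemma rep_mor_tens1l R (e : rep_tens rep_unit R = R :> rep_cat H B) :
  rep_mor (eqm e) = lun (sub_val R).
Proof. exact: rep_mor_eqm. Qed.

Lemma rep_mor_tens1r R (e : rep_tens R rep_unit = R :> rep_cat H B) :
  rep_mor (eqm e) = run (sub_val R).
Proof. exact: rep_mor_eqm. Qed.

Lemma rep_strict_monoidal :
  @is_strict_monoidal (rep_cat H B) rep_tens rep_tens_mor rep_unit.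
Proof.
exists rep_tensA rep_tens1l rep_tens1r => *; apply: rep_hom_eq.
- exact: tmor1.
- exact: tmorM.
- rewrite /= !rep_mor_tensA; exact: asc_nat.
- rewrite /= !rep_mor_tens1l; exact: lun_nat.
- rewrite /= !rep_mor_tens1r; exact: run_nat.
Qed.

Lemma rep_sym_morP (cc : cocommutative B) R S :
  intertwines (rep_tens R S) (rep_tens S R) (sym R S).
Proof.
by apply/intertwinesE; rewrite !theta_rep_tens; apply: tens_action_sym cc.
Qed.

Lemma rep_is_symmetry (cc : cocommutative B) :
  @is_symmetry (rep_cat H B) (StrictMonoidal rep_strict_monoidal)
    (fun R S =>
       RepHom (rep_tens R S) (rep_tens S R) (sym R S) (rep_sym_morP cc R S)).
Proof.
split=> *; apply: rep_hom_eq.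
- exact: symN.
- exact: symK (symP C) _ _.
- rewrite /= /assoc_mor !rep_mor_tensA; exact: sym_hexagon (symP C) _ _ _.
- rewrite /= /lunit_mor /runit_mor rep_mor_tens1l rep_mor_tens1r.
  exact: sym_unit (symP C) _.
Qed.

End RepresentationsAsActions.

Theorem theorem3p18 (C : symmetric_category) (P : full_monoidal_subcategory C)
    (H : relatively_closed P) (B : bimonoid C) :
  exists (HT : forall R R' : rep_ob H B, is_rep (rep_tens_map R R'))
         (H1 : is_rep (rep_unit_map H B)),
  let tens (R R' : rep_ob H B) : rep_ob H B :=
    RepOb (sub_tens R R') (rep_tens_map R R') (HT R R') in
  let unit : rep_ob H B :=
    RepOb (sub_unit P) (rep_unit_map H B) H1 in
  exists (Hm : forall (R S R' S' : rep_ob H B)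
                 (f : rep_hom R S) (f' : rep_hom R' S'),
               intertwines (tens R R') (tens S S') (f ⊠ f')),
  let tens_mor (R S R' S' : rep_ob H B) (f : rep_hom R S) (f' : rep_hom R' S')
      : rep_hom (tens R R') (tens S S') :=
    RepHom (tens R R') (tens S S') (f ⊠ f') (Hm R S R' S' f f') in
  exists HM : @is_strict_monoidal (rep_cat H B) tens tens_mor unit,
    cocommutative B ->
    exists Hs : forall R R' : rep_ob H B,
                intertwines (tens R R') (tens R' R) (sym R R'),
      @is_symmetry (rep_cat H B) (StrictMonoidal HM)
        (fun R R' : rep_ob H B => RepHom (tens R R') (tens R' R) (sym R R') (Hs R R')).
Proof.
exists (@rep_tensP _ _ H B), (@rep_unitP _ _ H B), (@rep_tens_morP _ _ H B).
exists (@rep_strict_monoidal _ _ H B) => cc.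
exists (rep_sym_morP cc); exact: rep_is_symmetry.
Qed.
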